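(* Let $P\subseteq\mathbb{R}^n$ be a full-dimensional ordinary polyhedron, with its unique irredundant representation as an intersection of finitely many closed halfspaces. Then $P$ is tropically convex if and only if each of these defining halfspaces is tropically convex.
   Context: Tropical operations: $x\oplus y=\min(x,y)$ and $x\odot y=x+y$. For $c\in\mathbb{R}$ and $x\in\mathbb{R}^n$, $c\odot x=(c+x_1,\dots,c+x_n)$, and $\oplus$ of vectors is the coordinatewise minimum. A set $U\subseteq\mathbb{R}^n$ is tropically convex if $(c\odot x)\oplus(d\odot y)\in U$ for all $x,y\in U$ and all $c,d\in\mathbb{R}$ with $\min(c,d)=0$. *)

(* Defs.v *)
From mathcomp Require Import all_boot all_order all_algebra.
From mathcomp Require Import boolp classical_sets functions cardinality reals.

Set Implicit Arguments.
Unset Strict Implicit.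
Unset Printing Implicit Defensive.

Import Order.TTheory GRing.Theory Num.Theory.
Local Open Scope classical_set_scope.
Local Open Scope ring_scope.

Section Defs.
Variables (R : realType) (n : nat).
Implicit Types (x y a : 'rV[R]_n) (c d b : R).
Implicit Types (P U H : set 'rV[R]_n) (HH : set (set 'rV[R]_n)).

Definition trop_add x y : 'rV[R]_n := \row_i Num.min (x 0 i) (y 0 i).

Definition trop_scale c x : 'rV[R]_n := \row_i (c + x 0 i).

Definition tropically_convex U : Prop :=
  forall x y, U x -> U y ->
  forall c d, Num.min c d = 0 ->
  U (trop_add (trop_scale c x) (trop_scale d y)).

Definition halfspace a b : set 'rV[R]_n :=
  [set x | \sum_(i < n) a 0 i * x 0 i <= b].

Definition closed_halfspace H : Prop :=
  exists a b, a != 0 /\ H = halfspace a b.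

Definition halfspace_rep P HH : Prop :=
  [/\ finite_set HH,
      (forall H, HH H -> closed_halfspace H)
    & P = \bigcap_(H in HH) H].

Definition polyhedron P : Prop := exists HH, halfspace_rep P HH.

Definition irredundant_rep P HH : Prop :=
  halfspace_rep P HH /\
  (forall H, HH H -> \bigcap_(K in HH `\ H) K <> P).

Definition affine_hull P : set 'rV[R]_n :=
  [set z | exists (k : nat) (t : 'I_k -> R) (v : 'I_k -> 'rV[R]_n),
    [/\ forall i, P (v i), \sum_(i < k) t i = 1
      & z = \sum_(i < k) t i *: v i]].

(* dim P = n, the dimension of P being that of its affine hull. *)
Definition full_dimensional P : Prop := affine_hull P = setT.

End Defs.

(* Main.v *)
Require Import Defs.
From mathcomp Require Import all_boot all_order all_algebra.
From mathcomp Require Import boolp classical_sets functions cardinality reals.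
From mathcomp Require Import ring lra.

(** If [H] is a defining halfspace of [P], irredundancy and full-dimensionality
    give a point [w] on the boundary of [H] lying strictly inside all the other
    defining halfspaces.  A homothety of ratio [e > 0] centred at [w] sends
    [min (c + x, d + y)] to [min (e c + x', e d + y')], where [x'], [y'] are the
    images of [x], [y].  For [x], [y] in [H] and [e] small, [x'] and [y'] lie in
    [P], so tropical convexity of [P] puts the image of the combination in [H];
    since [w] is on the boundary of [H], the combination itself is in [H]. *)

Set Implicit Arguments.
Unset Strict Implicit.
Unset Printing Implicit Defensive.

Import Order.TTheory GRing.Theory Num.Theory.
Local Open Scope classical_set_scope.
Local Open Scope ring_scope.

Section TropicalPolyhedra.
Variables (R : realType) (n : nat).
Implicit Types (x y w p q a : 'rV[R]_n) (b e t : R).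
Implicit Types (P U H K : set 'rV[R]_n) (HH : set (set 'rV[R]_n)).

Definition dot a x : R := \sum_(i < n) a 0 i * x 0 i.

Lemma dotD a x y : dot a (x + y) = dot a x + dot a y.
Proof.
by rewrite /dot -big_split; apply: eq_bigr => i _; rewrite mxE mulrDr.
Qed.

Lemma dotZ a t x : dot a (t *: x) = t * dot a x.
Proof. by rewrite /dot mulr_sumr; apply: eq_bigr => i _; rewrite mxE mulrCA. Qed.

Lemma dot_sum a k (v : 'I_k -> 'rV[R]_n) :
  dot a (\sum_(i < k) v i) = \sum_(i < k) dot a (v i).
Proof.
rewrite /dot exchange_big; apply: eq_bigr => i _.
by rewrite summxE mulr_sumr.
Qed.

Lemma dot_gt0 a : a != 0 -> 0 < dot a a.
Proof.
move=> a0; have sq_ge0 i : true -> 0 <= a 0 i * a 0 i by rewrite -expr2 sqr_ge0.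
rewrite lt_neqAle sumr_ge0 // andbT eq_sym; apply: contra_neq a0 => /eqP.
rewrite psumr_eq0 // => /allP a_eq0; apply/rowP => i.
have /implyP/(_ isT) := a_eq0 i (mem_index_enum i).
by rewrite mulf_eq0 orbb mxE => /eqP.
Qed.

Definition homothety w t x := (1 - t) *: w + t *: x.

Lemma dot_homothety a w t x :
  dot a (homothety w t x) = (1 - t) * dot a w + t * dot a x.
Proof. by rewrite dotD !dotZ. Qed.

(** In each coordinate the centre adds the same term to both arguments of the minimum, and
    multiplication by [t >= 0] commutes with [Num.min]. *)
Lemma homothety_trop w x y c d t : 0 <= t ->
  homothety w t (trop_add (trop_scale c x) (trop_scale d y)) =
  trop_add (trop_scale (t * c) (homothety w t x))
           (trop_scale (t * d) (homothety w t y)).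
Proof.
move=> t0; apply/rowP => i; rewrite !mxE minr_pMr // addr_minr.
by congr Num.min; ring.
Qed.

(** The algebraic interior of [K], phrased through homotheties so that a point of the core can
    shrink any [x] into [K] without topology. The bound [e] may depend on [x]. *)
Definition core K : set 'rV[R]_n :=
  [set w | forall x, exists2 e, 0 < e &
    forall t, 0 < t -> t <= e -> K (homothety w t x)].

Lemma core_halfspace a b w : a != 0 -> core (halfspace a b) w <-> dot a w < b.
Proof.
(* Moving from [w] in the direction [a] strictly increases [dot a], yet some such move stays in the
   halfspace. *)
move=> a0; have aa := dot_gt0 a0; split=> [/(_ (w + a)) [e e0 /(_ e e0 (lexx _))]|].
  by rewrite /halfspace /= -/(dot _ _) dot_homothety dotD; nra.
move=> wb x; case: (leP (dot a x) b) => xb.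
  exists 1 => // t t0 t1; rewrite /halfspace /= -/(dot _ _) dot_homothety; nra.
have d0 : 0 < dot a x - dot a w by lra.
(* The ratio at which the segment from [w] to [x] meets the boundary hyperplane. *)
exists ((b - dot a w) / (dot a x - dot a w)).
  by rewrite divr_gt0 // subr_gt0.
move=> t t0; rewrite ler_pdivlMr // => tle.
by rewrite /halfspace /= -/(dot _ _) dot_homothety; lra.
Qed.

(** The weight [1 - t] of [p] is positive, so the strict inequality at [p] survives in the
    combination. *)
Lemma core_homothety K p q t : closed_halfspace K -> core K p -> K q ->
  0 <= t < 1 -> core K (homothety p t q).
Proof.
case=> a [b [a0 ->]] /(core_halfspace _ _ a0) pb.
rewrite /halfspace /= -/(dot _ _) => qb /andP[t0 t1].
by apply/(core_halfspace _ _ a0); rewrite dot_homothety; nra.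
Qed.

Lemma halfspace_homothety K p q t : closed_halfspace K -> K p -> K q ->
  0 <= t <= 1 -> K (homothety p t q).
Proof.
case=> a [b [_ ->]]; rewrite /halfspace /= -!/(dot _ _) => pb qb /andP[t0 t1].
by rewrite dot_homothety; nra.
Qed.

Lemma full_dimensional_nonempty P : full_dimensional P -> exists p, P p.
Proof.
move=> fP; have : affine_hull P 0 by rewrite fP.
(* An empty family has weights summing to 0, not 1. *)
case=> -[|k] [t [v [Pv t1 _]]]; last by exists (v ord0).
by move/eqP: t1; rewrite big_ord0 eq_sym oner_eq0.
Qed.

(** Otherwise [P], and with it its affine hull, would lie in the boundary hyperplane of [K]. *)
Lemma full_dimensional_core P K : full_dimensional P -> P `<=` K ->
  closed_halfspace K -> exists2 v, P v & core K v.
Proof.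
move=> fP PK [a [b [a0 KE]]]; apply: contrapT => noP.
have eq_b v : P v -> dot a v = b.
  move=> Pv; apply/eqP; rewrite eq_le; apply/andP; split.
    by have := PK v Pv; rewrite KE.
  rewrite leNgt; apply/negP => vb; apply: noP; exists v => //.
  by rewrite KE; apply/core_halfspace.
have hull_b z : dot a z = b.
  have : affine_hull P z by rewrite fP.
  case=> k [t [v [Pv t1 ->]]]; rewrite dot_sum.
  under eq_bigr => i _ do rewrite dotZ eq_b //.
  by rewrite -mulr_suml t1 mul1r.
(* With [dot a] constantly [b], additivity gives [b + b = b], while [dot a a = b] is positive. *)
have := dot_gt0 a0; have := hull_b (a + a); rewrite dotD !hull_b; lra.
Qed.

(** Induction on a list of the halfspaces: the midpoint of a point interior to those already treated
    and a point interior to the next one is interior to all of them, and stays in [P] by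
    convexity. *)
Lemma full_dimensional_interior P HH : full_dimensional P ->
  halfspace_rep P HH -> exists2 p, P p & forall K, HH K -> core K p.
Proof.
move=> fP [/finite_seqP[s HHE] HHc PE].
have PK K : HH K -> P `<=` K by move=> HK x; rewrite PE; apply.
have : forall K, K \in s -> HH K by move=> K; rewrite HHE.
suff: (forall K, K \in s -> HH K) ->
    exists2 p, P p & forall K, K \in s -> core K p.
  by move=> /[apply] -[p Pp sp]; exists p => // K; rewrite HHE; apply: sp.
elim: {HHE} s => [_|K s IHs sHH].
  by have [p Pp] := full_dimensional_nonempty fP; exists p.
have [L sL|p Pp sp] := IHs; first by apply: sHH; rewrite inE sL orbT.
have HK : HH K by apply: sHH; rewrite inE eqxx.
have [v Pv Kv] := full_dimensional_core fP (PK K HK) (HHc K HK).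
have half01 : 0 <= (2^-1 : R) < 1 by lra.
(* [core_homothety] wants the interior point as centre: this is [v] for the new halfspace and [p]
   for the others. *)
have homothetyC : homothety p 2^-1 v = homothety v 2^-1 p.
  by rewrite /homothety addrC; congr (_ *: _ + _ *: _); field.
exists (homothety p 2^-1 v).
  rewrite PE => L HL; apply: halfspace_homothety (HHc L HL) _ _ _.
  - exact: PK Pp.
  - exact: PK Pv.
  - by lra.
move=> L; rewrite inE => /orP[/eqP ->|sL].
  by rewrite homothetyC; apply: core_homothety (PK K HK _ Pp) _ => //; exact: HHc.
have HL : HH L by apply: sHH; rewrite inE sL orbT.
by apply: core_homothety (PK L HL _ Pv) _ => //; [exact: HHc|exact: sp].
Qed.

(** By irredundancy some [q] satisfies all the other constraints but violates this one. The segment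
    from an interior point [p] to [q] crosses the boundary strictly before [q], hence still in the
    core of the others. *)
Lemma irredundant_facet_point P HH a b : full_dimensional P ->
  irredundant_rep P HH -> a != 0 -> HH (halfspace a b) ->
  exists2 w, dot a w = b & forall K, (HH `\ halfspace a b) K -> core K w.
Proof.
move=> fP [rep irr] a0 HHab; have [_ HHc PE] := rep.
have [p Pp /[dup] HHp /(_ _ HHab) /(core_halfspace _ _ a0) pb] :=
  full_dimensional_interior fP rep.
have [q HHq qb] : exists2 q, (\bigcap_(K in HH `\ halfspace a b) K) q & b < dot a q.
  apply: contrapT => noq; apply: (irr _ HHab); rewrite PE.
  apply/seteqP; split=> [q HHq K HK|q HHq K [HK _]]; last exact: HHq.
  have [->|neK] := pselect (K = halfspace a b); last by apply: HHq; split.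
  rewrite /halfspace /= leNgt; apply/negP => qb.
  by apply: noq; exists q.
have d0 : 0 < dot a q - dot a p by lra.
set t := (b - dot a p) / (dot a q - dot a p).
have tE : t * (dot a q - dot a p) = b - dot a p by rewrite divfK // gt_eqF.
have t01 : 0 <= t < 1.
  by rewrite divr_ge0 ?ltr_pdivrMr //= ?mul1r; lra.
exists (homothety p t q); first by rewrite dot_homothety; lra.
move=> K HK; apply: core_homothety (HHq K HK) t01.
  by apply: HHc; case: HK.
by apply: HHp; case: HK.
Qed.

Lemma finite_core_bigcap HH w x : finite_set HH ->
  (forall K, HH K -> core K w) ->
  exists2 e, 0 < e &
    forall t, 0 < t -> t <= e -> forall K, HH K -> K (homothety w t x).
Proof.
move=> /finite_seqP[s ->]; elim: s => [_|K s IHs sw]; first by exists 1.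
have [L sL|e e0 se] := IHs; first by apply: sw; rewrite /= inE sL orbT.
have [|e' e'0 Ke'] := sw K _ x; first by rewrite /= inE eqxx.
exists (Num.min e e') => [|t t0]; first by rewrite lt_min e0.
rewrite le_min => /andP[te te'] L; rewrite /= inE => /orP[/eqP ->|]; first exact: Ke'.
exact: se.
Qed.

Lemma tropically_convex_bigcap HH :
  (forall H, HH H -> tropically_convex H) ->
  tropically_convex (\bigcap_(H in HH) H).
Proof.
by move=> HHt x y Px Py c d cd K HK; apply: HHt => //; [exact: Px|exact: Py].
Qed.

Lemma tropically_convex_defining_halfspace P HH H : full_dimensional P ->
  irredundant_rep P HH -> tropically_convex P -> HH H -> tropically_convex H.
Proof.
move=> fP irr tP HHH; have [[fin HHc PE] _] := irr.
have [a [b [a0 HE]]] := HHc _ HHH; rewrite {}HE in HHH *.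
have [w wb HHw] := irredundant_facet_point fP irr a0 HHH.
have finD : finite_set (HH `\ halfspace a b) by exact: finite_setD.
move=> x y Hx Hy c d cd.
have [e e0 ex] := finite_core_bigcap x finD HHw.
have [f f0 fy] := finite_core_bigcap y finD HHw.
(* The bounds [e] and [f] take care of the other halfspaces; the bound 1 keeps the images on
   segments from [w], hence in the halfspace itself. *)
set t := Num.min 1 (Num.min e f).
have t0 : 0 < t by rewrite !lt_min ltr01 e0.
have [t1 te tf] : [/\ t <= 1, t <= e & t <= f].
  by split; rewrite /t !ge_min lexx ?orbT.
have inP z : halfspace a b z ->
    (forall K, (HH `\ halfspace a b) K -> K (homothety w t z)) ->
    P (homothety w t z).
  move=> Hz zK; rewrite PE => K HK.
  have [->|neK] := pselect (K = halfspace a b); last by apply: zK; split.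
  apply: halfspace_homothety => //; first exact: HHc.
    by rewrite /halfspace /= -/(dot _ _) wb.
  by rewrite ltW.
have tcd : Num.min (t * c) (t * d) = 0 by rewrite -minr_pMr ?ltW // cd mulr0.
have := tP _ _ (inP x Hx (ex t t0 te)) (inP y Hy (fy t t0 tf)) _ _ tcd.
rewrite -homothety_trop ?ltW // PE => /(_ _ HHH).
rewrite /halfspace /= -!/(dot _ _) dot_homothety wb => zb.
by rewrite -(ler_pM2l t0); lra.
Qed.

End TropicalPolyhedra.

Theorem theorem2p6 (R : realType) (n : nat) (P : set 'rV[R]_n)
    (HH : set (set 'rV[R]_n)) :
  polyhedron P -> full_dimensional P -> irredundant_rep P HH ->
  (tropically_convex P <-> forall H, HH H -> tropically_convex H).
Proof.
move=> _ fP irr; split=> [tP H|HHt].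
  exact: tropically_convex_defining_halfspace fP irr tP.
by case: irr => -[_ _ ->] _; exact: tropically_convex_bigcap.
Qed.
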